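(* Let $f$ be a real-valued, finite a.e. measurable function on $\mathbb{R}^n$, and let $0<s<1$. Then $$\lim_{x\in Q,\ Q\to x} m_f(s,Q)=f(x)\quad\text{for a.e. } x\in\mathbb{R}^n.$$ In particular, this limit relation holds at every point of continuity $x$ of $f$.
   Context: Cubes in $\mathbb{R}^n$ have sides parallel to the coordinate axes; $|E|$ denotes Lebesgue measure. For a cube $Q\subset\mathbb{R}^n$, $0<s<1$ and a real-valued measurable function $f$ on $Q$, $m_f(s,Q)$ denotes the maximal median of $f$ over $Q$ with parameter $s$: $$m_f(s,Q)=\sup\{M\in\mathbb{R}: |\{y\in Q: f(y)<M\}|\le s|Q|\}.$$ The limit $x\in Q,\ Q\to x$ is taken over all cubes $Q$ containing $x$ (not necessarily centered at $x$) as they shrink to $x$, i.e. as $|Q|\to 0$. *)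

(* Defs.v *)
From HB Require Import structures.
From mathcomp Require Import all_boot all_order all_algebra.
From mathcomp Require Import all_classical all_reals all_analysis.
From mathcomp Require Import measurable_realfun.

Set Implicit Arguments.
Unset Strict Implicit.
Unset Printing Implicit Defensive.

Import Order.TTheory GRing.Theory Num.Theory.
Import numFieldNormedType.Exports.
Local Open Scope classical_set_scope.
Local Open Scope ring_scope.

(** The Euclidean space of dimension n + 1 is ['rV[R]_n.+1]. Dimension 0 is
    excluded; there a box would be a point of volume 1 (an empty product) and
    [lebesgue_outer] below would not vanish on the empty set. *)

Section boxes.
Context {R : realType} {n : nat}.
Implicit Types a b : 'rV[R]_n.+1.

Definition box a b : set 'rV[R]_n.+1 :=
  [set x | forall i, a 0 i <= x 0 i <= b 0 i].

Definition box_volume a b : R := \prod_(i < n.+1) (b 0 i - a 0 i).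

(** Only closed cubes: the boundary is a null set, so that an open or half-open
    cube has the same measure and medians, and the closed one has more points. *)
Definition is_cube (Q : set 'rV[R]_n.+1) : Prop :=
  exists a (l : R), 0 < l /\ Q = box a (a + const_mx l).

End boxes.

Section lebesgue_outer_measure.
Context {R : realType} {n : nat}.
Implicit Types (A : set 'rV[R]_n.+1) (I : ('rV[R]_n.+1 * 'rV[R]_n.+1)^nat).
Local Open Scope ereal_scope.

Definition box_cover A :=
  [set I : ('rV[R]_n.+1 * 'rV[R]_n.+1)^nat |
           (forall k i, (I k).1 ord0 i <= (I k).2 ord0 i)%R /\
           A `<=` \bigcup_k box (I k).1 (I k).2].

Definition lebesgue_outer A : \bar R :=
  ereal_inf [set \sum_(k <oo) (box_volume (I k).1 (I k).2)%:E
            | I in box_cover A].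

Let vol (p : 'rV[R]_n.+1 * 'rV[R]_n.+1) : \bar R := (box_volume p.1 p.2)%:E.

Let vol_ge0 A I : box_cover A I -> forall k, 0 <= vol (I k).
Proof.
by move=> [Iok _] k; rewrite lee_fin; apply: prodr_ge0 => i _; rewrite subr_ge0.
Qed.

Lemma lebesgue_outer_ge0 A : 0 <= lebesgue_outer A.
Proof.
apply: le_ereal_inf_tmp => _ [I AI <-].
by apply: nneseries_ge0 => k _ _; exact: vol_ge0 AI k.
Qed.

Lemma le_lebesgue_outer : {homo lebesgue_outer : A B / A `<=` B >-> A <= B}.
Proof.
move=> A B AB; apply/ereal_inf_le_tmp => _ [I [Iok BI] <-].
by exists I => //; split => //; exact: subset_trans BI.
Qed.

Lemma lebesgue_outer0 : lebesgue_outer set0 = 0.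
Proof.
apply/eqP; rewrite eq_le lebesgue_outer_ge0 andbT.
apply: ereal_inf_lbound; exists (fun=> (0%R, 0%R)); first by split.
by apply: eseries0 => k _ _; rewrite /box_volume big_ord_recl /= subrr mul0r.
Qed.

Lemma lebesgue_outer_sigma_subadditive : sigma_subadditive lebesgue_outer.
Proof.
move=> A; have [[i ioo]|] := pselect (exists i, lebesgue_outer (A i) = +oo).
  rewrite (eseries_pinfty _ _ ioo) ?leey// => k _.
  by rewrite -ltNye (lt_le_trans _ (lebesgue_outer_ge0 _)).
rewrite -forallNE => Aoo.
suff add2e (e : {posnum R}) :
    lebesgue_outer (\bigcup_k A k) <=
    \sum_(i <oo) lebesgue_outer (A i) + e%:num%:E.
  by apply/lee_addgt0Pr => _/posnumP[].
rewrite (le_trans _ (epsilon_trick _ _ _))//; last first.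
  by move=> k; exact: lebesgue_outer_ge0.
pose P k I := box_cover (A k) I /\
  \sum_(j <oo) vol (I j) <=
  lebesgue_outer (A k) + (e%:num / (2 ^ k.+1)%:R)%:E.
have [G PG] : {G : nat -> ('rV[R]_n.+1 * 'rV[R]_n.+1)^nat
                 & forall k, P k (G k)}.
  apply: (@choice _ _ P) => k.
  have fink : lebesgue_outer (A k) \is a fin_num.
    by rewrite ge0_fin_numE ?lebesgue_outer_ge0// ltey; apply/eqP.
  have e0 : (0 < e%:num / (2 ^ k.+1)%:R :> R)%R by [].
  have [_ [I AI <-] Ilt] := lb_ereal_inf_adherent e0 fink.
  by exists I; split => //; exact: ltW.
have volG_ge0 x : 0 <= (vol \o uncurry G) x.
  by case: x => i j; exact: vol_ge0 (PG i).1 j.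
apply: (@le_trans _ _ (\esum_(i in setT) (vol \o uncurry G) i)).
  apply: ereal_inf_lbound => /=.
  have /card_esym/ppcard_eqP[f] := card_nat2.
  exists (uncurry G \o f).
    split => [k i|]; first by rewrite /= /uncurry; case: (f k) => p q;
      exact: (PG p).1.1.
    move=> t [i _ /((PG i).1.2) [j _ Bijt]].
    by exists (f^-1%FUN (i, j)) => //=; rewrite invK ?inE.
  rewrite -(esum_pred_image (vol \o uncurry G) _ xpredT) ?[fun=> _]set_true//.
  by rewrite image_eq.
rewrite (_ : esum _ _ = \sum_(i <oo) \sum_(j <oo) vol (G i j)); last first.
  pose J : nat -> set (nat * nat) := fun i => [set (i, j) | j in setT].
  rewrite (_ : setT = \bigcup_k J k); last first.
    by rewrite predeqE => -[a b]; split => // _; exists a => //; exists b.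
  rewrite esum_bigcupT //=; last first.
    apply/trivIsetP => i j _ _ ij.
    rewrite predeqE => -[k m] /=; split => //= -[] [_] _ [<-{k} _].
    by move=> [m' _] [] /esym/eqP; rewrite (negbTE ij).
  rewrite -(image_id [set: nat]) -fun_true esum_pred_image//; last first.
    by move=> k _; apply: esum_ge0 => x _; exact: volG_ge0.
  apply: eq_eseriesr => /= j _.
  rewrite -(esum_pred_image (vol \o uncurry G) (pair j) predT); last 2 first.
    by move=> k _; exact: volG_ge0.
    by move=> ? ? _ _; exact: (@can_inj _ _ _ snd).
  by congr esum; rewrite predeqE => -[a b]; split; move=> [i _ <-]; exists i.
apply: lee_nneseries => [i _ _|i _]; last exact: (PG i).2.
by apply: nneseries_ge0 => j _ _; exact: (volG_ge0 (i, j)).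
Qed.

HB.instance Definition _ := isOuterMeasure.Build R 'rV[R]_n.+1 lebesgue_outer
  lebesgue_outer0 lebesgue_outer_ge0 le_lebesgue_outer
  lebesgue_outer_sigma_subadditive.

End lebesgue_outer_measure.

Definition lebesgue_space (R : realType) (n : nat) :=
  caratheodory_type (@lebesgue_outer R n).

HB.instance Definition _ (R : realType) (n : nat) :=
  Measurable.on (lebesgue_space R n).

Definition lebesgue_mu {R : realType} {n : nat} :
  set (lebesgue_space R n) -> \bar R := lebesgue_outer.

HB.instance Definition _ (R : realType) (n : nat) :=
  isMeasure.Build _ (lebesgue_space R n) R (@lebesgue_mu R n)
    (@caratheodory_measure0 _ _ (@lebesgue_outer R n))
    (@caratheodory_measure_ge0 _ _ (@lebesgue_outer R n))
    (@caratheodory_measure_sigma_additive _ _ (@lebesgue_outer R n)).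

(** The supremum is taken in [\bar R], with values -oo and +oo for an empty
    and an unbounded set respectively. *)
Definition max_median {R : realType} {n : nat} (f : 'rV[R]_n.+1 -> \bar R)
    (s : R) (Q : set 'rV[R]_n.+1) : \bar R :=
  ereal_sup [set M%:E | M in [set M : R |
    (lebesgue_mu [set y | Q y /\ f y < M%:E] <= s%:E * lebesgue_mu Q)%E]].

(** The filter of the cubes containing x (centered at x or not) along which the
    measure of the cube tends to 0. *)
Definition cubes_to {R : realType} {n : nat} (x : 'rV[R]_n.+1) :
    set_system (set 'rV[R]_n.+1) :=
  filter_from [set d : R | 0 < d]
    (fun d => [set Q | [/\ is_cube Q, Q x & (lebesgue_mu Q < d%:E)%E]]).

Global Instance cubes_to_filter {R : realType} {n : nat} (x : 'rV[R]_n.+1) :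
  Filter (cubes_to x).
Proof.
apply: filter_from_filter; first by exists 1; exact: ltr01.
move=> d e d0 e0; exists (Num.min d e); first by rewrite /= lt_min; apply/andP.
move=> Q [cQ Qx]; rewrite EFin_min lt_min => /andP[Qd Qe].
by split; split.
Qed.

(* Main.v *)
(** A real q lies below m_f(s,Q) as soon as |Q ∩ {f < q}| <= s|Q|, and above it
    as soon as |Q ∩ {f < q}| > s|Q|. If x is a point of continuity, small cubes
    around x lie entirely inside or outside {f < q} whenever q != f(x). In
    general, for almost every x and every rational q, x is a density point of
    {f < q} or of its complement, according to which of them contains x; as
    0 < s < 1 this again decides on which side of q the medians of small cubes
    lie.

    Density points (along arbitrary cubes containing x): if C has finite measure
    and cubes Q shrinking to points of B, a subset of C, satisfy
    |Q \ C| > t|Q|, then all these cubes may be taken inside a neighbourhood U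
    of C with |U \ C| < e, and a disjoint Vitali subfamily, whose five-fold
    dilations cover B, gives |B| <= 5^(n+1) e / t. *)

Require Import Defs.
From mathcomp Require Import all_boot all_order all_algebra.
From mathcomp Require Import all_classical all_reals all_analysis.
From mathcomp Require Import measurable_realfun lra.

Import Order.TTheory GRing.Theory Num.Theory.
Import numFieldNormedType.Exports.
Local Open Scope classical_set_scope.
Local Open Scope ring_scope.

(** * Measure and measurability of boxes *)

Lemma nneseries_ge_term (R : realType) (u : nat -> \bar R) (k : nat) :
  (forall i, 0 <= u i)%E -> (u k <= \sum_(i <oo) u i)%E.
Proof.
move=> u0; rewrite (@nneseriesD1 _ _ k)// leeDl//.
by apply: nneseries_ge0 => i _ _; exact: u0.
Qed.

(* Induction on the dimension: fixing the last coordinate at t multiplies the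
   weight of the k-th box by the indicator of [p k m, q k m] at t, and the
   inequality for slices is then integrated over t. *)
Lemma weighted_box_volume_le (R : realType) (m : nat) (a b : nat -> R)
    (p q : nat -> nat -> R) (w : nat -> R) :
  (forall i, (i < m)%N -> a i <= b i) ->
  (forall k i, p k i <= q k i) -> (forall k, 0 <= w k) ->
  (forall x : nat -> R, (forall i, (i < m)%N -> a i <= x i <= b i) ->
     (1 <= \sum_(k <oo) (w k * \prod_(i < m) (p k i <= x i <= q k i)%R%:R)%R%:E)%E) ->
  ((\prod_(i < m) (b i - a i))%:E
     <= \sum_(k <oo) (w k * \prod_(i < m) (q k i - p k i))%R%:E)%E.
Proof.
elim: m w => [|m IH] w ab pq w0 cov.
  (* All products are empty in dimension 0, so the hypothesis at any point, here [a], is the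
     claim. *)
  rewrite big_ord0 (le_trans (cov a _))//.
  by apply: lee_nneseries => k _ *; rewrite ?big_ord0 // lee_fin mulr1.
pose D : set R := `[a m, b m]%classic.
pose P := \prod_(i < m) (b i - a i).
pose V k := \prod_(i < m) (q k i - p k i).
have P0 : 0 <= P.
  by apply: prodr_ge0 => i _; rewrite subr_ge0 ab// ltnS ltnW.
have V0 k : 0 <= V k by apply: prodr_ge0 => i _; rewrite subr_ge0 pq.
pose f k (t : R) : \bar R := ((w k * V k)%:E * (\1_(`[p k m, q k m]%classic) t)%:E)%E.
have mD : measurable D by exact: measurable_itv.
have f0 k t : (0 <= f k t)%E.
  by rewrite mule_ge0// lee_fin// mulr_ge0.
have mi k : measurable_fun D (@EFin R \o \1_(`[p k m, q k m]%classic : set R)).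
  apply/measurable_EFinP; apply: measurable_funTS; apply: measurable_indic.
  exact: measurable_itv.
have mf k : measurable_fun D (f k).
  rewrite /f; apply: emeasurable_funM; [exact: measurable_cst|exact: mi].
have slice t : D t -> (P%:E <= \sum_(k <oo) f k t)%E.
  move=> Dt.
  have fE k : f k t = (w k * (p k m <= t <= q k m)%R%:R * V k)%:E.
    rewrite /f indicE -EFinM mulrAC; congr (_ * _%:R * _)%:E.
    by congr nat_of_bool; apply/idP/idP; rewrite inE /= in_itv.
  under eq_eseriesr => k _ do rewrite fE.
  apply: IH => //= [i im|k|x xab].
  - by rewrite ab// ltnS ltnW.
  - by rewrite mulr_ge0.
  pose y i := if i == m then t else x i.
  apply: le_trans (cov y _) _ => [i|].
    rewrite ltnS leq_eqVlt /y => /predU1P[->|im].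
      by rewrite eqxx; move: Dt; rewrite /D /= in_itv.
    by rewrite ltn_eqF// xab.
  apply: lee_nneseries => k _ *; rewrite ?lee_fin ?mulr_ge0 ?prodr_ge0//.
  rewrite big_ord_recr /= [y m]/y eqxx mulrA mulrAC.
  by under eq_bigr => i _ do rewrite /y ltn_eqF//.
rewrite big_ord_recr /= -/P EFinM.
have le1 : (\int[lebesgue_measure]_(x in D) P%:E <=
    \int[lebesgue_measure]_(x in D) (\sum_(k <oo) f k x))%E.
  apply: ge0_le_integral => //=.
  by apply: ge0_emeasurable_sum => [k x Dx _|k _]; [exact: f0|exact: mf].
apply: (le_trans _ (le_trans le1 _)).

  rewrite integral_cst//= /D lebesgue_measure_itv /= lte_fin.
  case: ltP => // h; rewrite mule0 -EFinM lee_fin.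
  by rewrite mulr_ge0_le0// subr_le0.
rewrite integral_nneseries//; apply: lee_nneseries => k _.
  by move=> *; apply: integral_ge0 => x _; exact: f0.
rewrite /f ge0_integralZl_EFin//; first last.
- by rewrite mulr_ge0.
- exact: mi.
rewrite integral_indic//.
rewrite big_ord_recr /= mulrA -/(V k) [leRHS]EFinM lee_wpmul2l//;
  first by rewrite lee_fin mulr_ge0.
apply: (@le_trans _ _ (lebesgue_measure (`[p k m, q k m]%classic : set R))).
  apply: le_measure; rewrite ?inE; last exact: subIsetl.
    by apply: measurableI => //; exact: measurable_itv.
  exact: measurable_itv.
rewrite lebesgue_measure_itv /= lte_fin; case: ltP => // _.
by rewrite lee_fin subr_ge0.
Qed.

Section boxes.
Context {R : realType} {n : nat}.
Implicit Types (a b : 'rV[R]_n.+1) (l : R).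

Lemma box_volume_ge0 a b : (forall i, a 0 i <= b 0 i) -> 0 <= box_volume a b.
Proof. by move=> ab; apply: prodr_ge0 => i _; rewrite subr_ge0. Qed.

(** The box covers itself, which bounds its outer measure above. Conversely, every point lies in
    some box of a given cover, whose indicator is then 1, so the weighted inequality applies with
    unit weights. *)
Lemma lebesgue_outer_box a b : (forall i, a 0 i <= b 0 i) ->
  lebesgue_outer (box a b) = (box_volume a b)%:E.
Proof.
move=> ab; apply/eqP; rewrite eq_le; apply/andP; split.
  apply: ereal_inf_lbound.
  (* The padding boxes [(0, 0)] have volume 0 because there is at least one coordinate. *)
  exists (fun k => if k == 0%N then (a, b) else (0, 0)).
    by split => [[|k] i //|x xab]; exists 0%N.
  rewrite (@nneseriesD1 _ _ 0)//.
    rewrite eseries0 ?adde0// => -[|k] _ //= _.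
    by rewrite /box_volume big_ord_recl /= subrr mul0r.
  move=> [|k] _; rewrite lee_fin box_volume_ge0//.
apply: le_ereal_inf_tmp => _ [I [Iok Icov] <-].
(* [inord] turns row vectors into sequences indexed by [nat], the form suited to induction on the
   dimension. *)
have := @weighted_box_volume_le R n.+1 (fun i => a 0 (inord i))
  (fun i => b 0 (inord i)) (fun k i => (I k).1 0 (inord i))
  (fun k i => (I k).2 0 (inord i)) (fun=> 1).
have vE (x y : 'rV[R]_n.+1) :
    \prod_(i < n.+1) (y 0 (inord i) - x 0 (inord i)) = box_volume x y.
  by apply: eq_bigr => i _; rewrite inord_val.
rewrite vE; under eq_eseriesr => k _ do rewrite vE mul1r.
apply => //= x xab.
have [|k _ Ikx] := Icov (\row_i x i).
  by move=> i; rewrite mxE; have := xab i; rewrite inord_val; exact.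
rewrite [leRHS](_ : _ = \sum_(j <oo)
  (\prod_(i < n.+1) ((I j).1 0 (inord i) <= x i <= (I j).2 0 (inord i))%R%:R)%R%:E)%E;
  last first.
  by apply: eq_eseriesr => j _; rewrite mul1r.
apply: (le_trans _ (@nneseries_ge_term _ _ k _)) => [|j]; last first.
  by rewrite lee_fin prodr_ge0.
rewrite big1// => i _; rewrite inord_val.
by have := Ikx i; rewrite mxE => ->.
Qed.

Lemma lebesgue_outer_cube a l : 0 <= l ->
  lebesgue_outer (box a (a + const_mx l)) = (l ^+ n.+1)%:E.
Proof.
move=> l0; rewrite lebesgue_outer_box => [|i]; last by rewrite !mxE lerDl.
rewrite /box_volume; under eq_bigr => i _ do rewrite !mxE addrAC subrr add0r.
by rewrite prodr_const card_ord.
Qed.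

Lemma measurable_halfspace (A : set 'rV[R]_n.+1) (j : 'I_n.+1) (c : R) :
  [set x : 'rV[R]_n.+1 | x 0 j < c] `<=` A ->
  A `<=` [set x : 'rV[R]_n.+1 | x 0 j <= c] ->
  measurable (A : set (lebesgue_space R n)).
Proof.
(* Clipping the j-th coordinate at c cuts every covering box into two boxes, one
   of them possibly degenerate, whose volumes add up. *)
move=> ltA Ale; apply: le_caratheodory_measurable => X /=.
apply: le_ereal_inf_tmp => _ [I [Iok Icov] <-].
pose lo (p : 'rV[R]_n.+1) : 'rV[R]_n.+1 :=
  \row_i if i == j then Num.min (p 0 i) c else p 0 i.
pose hi (p : 'rV[R]_n.+1) : 'rV[R]_n.+1 :=
  \row_i if i == j then Num.max (p 0 i) c else p 0 i.
have volE p q : box_volume p q = box_volume (lo p) (lo q) + box_volume (hi p) (hi q).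
  have vol1 (x y : 'rV[R]_n.+1) : box_volume x y =
      (y 0 j - x 0 j) * \prod_(i < n.+1 | i != j) (y 0 i - x 0 i).
    by rewrite /box_volume (bigD1 j).
  rewrite !vol1.
  have restE (g : 'rV[R]_n.+1 -> 'rV[R]_n.+1) : g = lo \/ g = hi ->
      \prod_(i < n.+1 | i != j) (g q 0 i - g p 0 i)
      = \prod_(i < n.+1 | i != j) (q 0 i - p 0 i).
    by move=> -[->|->]; apply: eq_bigr => i /negbTE ij; rewrite !mxE ij.
  rewrite (restE lo); last by left.
  rewrite (restE hi); last by right.
  rewrite !mxE eqxx -mulrDl; congr (_ * _).
  have := addr_max_min (q 0 j) c; have := addr_max_min (p 0 j) c; lra.
have lo_ok k i : lo (I k).1 0 i <= lo (I k).2 0 i.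
  by rewrite !mxE; case: ifP => _; rewrite ?le_min2 ?Iok.
have hi_ok k i : hi (I k).1 0 i <= hi (I k).2 0 i.
  by rewrite !mxE; case: ifP => _; rewrite ?le_max2 ?Iok.
under eq_eseriesr => k _ do rewrite volE EFinD.
rewrite nneseriesD => [|k _ _|k _ _]; [|by rewrite lee_fin box_volume_ge0..].
apply: leeD; apply: ereal_inf_lbound.
  exists (fun k => (lo (I k).1, lo (I k).2)) => //; split => // x [Xx Ax].
  have [k _ Ikx] := Icov x Xx; exists k => // i.
  have /andP[p_x x_q] := Ikx i; have := Ale x Ax; rewrite /= !mxE.
  case: eqVneq => [ij|_ _]; last by rewrite p_x.
  by rewrite -ij => xc; rewrite ge_min le_min xc p_x x_q.
exists (fun k => (hi (I k).1, hi (I k).2)) => //; split => // x [Xx Ax].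
have [k _ Ikx] := Icov x Xx; exists k => // i.
have /andP[p_x x_q] := Ikx i; rewrite /= !mxE.
case: eqVneq => [ij|_]; last by rewrite p_x.
have cx : c <= x 0 i by rewrite ij leNgt; apply/negP => /ltA.
by rewrite ge_max le_max cx p_x x_q.
Qed.

Lemma measurable_box a b : measurable (box a b : set (lebesgue_space R n)).
Proof.
rewrite (_ : box a b = \bigcap_(i in [set: 'I_n.+1])
    ([set x | a 0 i <= x 0 i] `&` [set x | x 0 i <= b 0 i])); last first.
  apply/seteqP; split => [x xab i _|x xab i].
    by have /andP[] := xab i.
  by apply/andP; exact: xab.
apply: fin_bigcap_measurable => // i _; apply: measurableI.
  (* The lower constraint is the complement of an open halfspace, the upper one a closed halfspace;
     [measurable_halfspace] covers both. *)
  rewrite -[X in measurable X]setCK; apply: measurableC.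
  apply: (@measurable_halfspace _ i (a 0 i)) => x /=; first by rewrite ltNge => /negP.
  by move/negP; rewrite -ltNge => /ltW.
by apply: (@measurable_halfspace _ i (b 0 i)) => // x /ltW.
Qed.

End boxes.

(** * Vitali selection and countability of disjoint cubes *)

Lemma vitali_selection (R : realType) (T I : Type) (B : I -> set T)
    (l : I -> R) (V : set I) (r : R) :
  (forall i, V i -> 0 < l i <= r) -> (forall i, V i -> B i !=set0) ->
  exists D : set I, [/\ D `<=` V, trivIset D B &
    forall i, V i -> exists j, [/\ D j, B i `&` B j !=set0 & l i <= 2 * l j]].
Proof.
(* A maximal disjoint subfamily in which every member of V that it meets is
   dominated up to a factor 2 must meet all of V: otherwise it could be enlarged
   by a nearly largest member that it misses. *)
move=> lr B0.
pose P (D : set I) := [/\ D `<=` V, trivIset D B &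
  forall i j, V i -> D j -> B i `&` B j !=set0 ->
    exists k, [/\ D k, B i `&` B k !=set0 & l i <= 2 * l k]].
have [D [[DV tD domD] maxD]] : exists D, P D /\ forall E, D `<` E -> ~ P E.
  apply: Zorn_bigcup => F FP Ftot; split.
  - by move=> i [X FX Xi]; have [XV _ _] := FP X FX; exact: XV.
  - move=> i j [X FX Xi] [Y FY Yj].
    have [tX tY] : trivIset X B /\ trivIset Y B.
      by split; [have [] := FP X FX|have [] := FP Y FY].
    by have [XY|YX] := Ftot X Y FX FY; [apply: tY|apply: tX] => //;
      [exact: XY|exact: YX].
  - move=> i j Vi [X FX Xj] ij; have [_ _ domX] := FP X FX.
    by have [k [Xk ik lik]] := domX i j Vi Xj ij; exists k; split => //; exists X.
exists D; split => // i Vi.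
have [[j [Dj ij]]|noj] := pselect (exists j, D j /\ B i `&` B j !=set0).
  exact: domD ij.
exfalso.
pose far := [set k | V k /\ forall j, D j -> ~ (B k `&` B j !=set0)].
have fari : far i by split => // j Dj ij; apply: noj; exists j.
have hsup : has_sup (l @` far).
  split; first by exists (l i), i.
  by exists r => _ [k [Vk _] <-]; have /andP[] := lr k Vk.
have sup0 : 0 < sup (l @` far).
  have /andP[li0 _] := lr i Vi; apply: (lt_le_trans li0).
  by apply: ub_le_sup; [exact: hsup.2|exists i].
have [|_ [k [Vk fark] <-] lk] := @sup_adherent R _ (sup (l @` far) / 2) _ hsup.
  by rewrite divr_gt0.
have [x Bkx] := B0 k Vk.
have Dk : ~ D k by move=> Dk; apply: (fark k Dk); exists x.
apply: (maxD (D `|` [set k])).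
  split; first exact: subsetUl.
  by move=> /(_ k (or_intror erefl)).
split.
- by move=> j [/DV//|->].
- move=> p q [Dp|->] [Dq|->] // pq; first exact: tD pq.
    by case: (fark p Dp); rewrite setIC.
  by case: (fark q Dq).
- move=> p q Vp Dq pq.
  (* If [p] meets a member of [D], then [D] dominates it already. Otherwise [p] is in [far], so
     [l p] is at most the supremum, hence at most [2 * l k]. *)
  have [[j [Dj pj]]|nop] := pselect (exists j, D j /\ B p `&` B j !=set0).
    by have [h [Dh ? ?]] := domD p j Vp Dj pj; exists h; split => //; left.
  exists q; split => //.
  case: Dq pq => [Dq pq|-> pk]; first by case: nop; exists q.
  have : l p <= sup (l @` far).
    apply: ub_le_sup; first exact: hsup.2.
    by exists p => //; split => // j Dj pj; apply: nop; exists j.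
  lra.
Qed.

(** The index is a corner and a side length, so that the Vitali selection can take the second
    component as the size. *)
Definition cube {R : realType} {n : nat} (p : 'rV[R]_n.+1 * R) :
  set 'rV[R]_n.+1 := box p.1 (p.1 + const_mx p.2).

Section cubes.
Context {R : realType} {n : nat}.
Implicit Types p q : 'rV[R]_n.+1 * R.

Lemma cubeP p x : cube p x <-> forall i, p.1 0 i <= x 0 i <= p.1 0 i + p.2.
Proof. by split => px i; have := px i; rewrite !mxE. Qed.

Lemma is_cubeP (Q : set 'rV[R]_n.+1) :
  is_cube Q <-> exists2 p, 0 < p.2 & Q = cube p.
Proof.
by split => [[a [l [l0 ->]]]|[[a l] l0 ->]]; [exists (a, l)|exists a, l].
Qed.

Lemma measurable_cube p : measurable (cube p : set (lebesgue_space R n)).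
Proof. exact: measurable_box. Qed.

Lemma lebesgue_mu_cube p : 0 <= p.2 -> lebesgue_mu (cube p) = (p.2 ^+ n.+1)%:E.
Proof. exact: lebesgue_outer_cube. Qed.

Lemma cube_nonempty p : 0 <= p.2 -> cube p !=set0.
Proof. by move=> p0; exists p.1; apply/cubeP => i; rewrite lexx lerDl. Qed.

(** Each cube of positive side contains a rational point, and disjoint cubes cannot share one. *)
Lemma trivIset_cube_countable (D : set ('rV[R]_n.+1 * R)) :
  (forall p, D p -> 0 < p.2) -> trivIset D cube -> countable D.
Proof.
move=> D0 tD.
have rat_in p : exists q : 'rV[rat]_n.+1, D p -> cube p (map_mx ratr q).
  have [Dp|nDp] := pselect (D p); last by exists 0.
  have /fin_all_exists[q Hq] i : exists q : rat, p.1 0 i <= ratr q <= p.1 0 i + p.2.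
    have [|q] := @rat_in_itvoo R (p.1 0 i) (p.1 0 i + p.2); first by rewrite ltrDl D0.
    by rewrite in_itv => /andP[/ltW ? /ltW ?]; exists q; apply/andP.
  by exists (\row_i q i) => _; apply/cubeP => i; rewrite !mxE.
have [f Hf] := choice rat_in.
apply/countable_injP; exists (fun p => pickle (f p)) => p q /set_mem Dp /set_mem Dq.
move/(pcan_inj pickleK) => fpq; apply: tD => //.
by exists (map_mx ratr (f p)); split; [|rewrite fpq]; exact: Hf.
Qed.

(** Points of [cube p] are at sup-distance at most [2 * q.2] from [cube q]; widening by this on both
    sides gives side [5 * q.2]. *)
Lemma cube_sub_dilation p q : cube p `&` cube q !=set0 -> p.2 <= 2 * q.2 ->
  cube p `<=` cube (q.1 - const_mx (2 * q.2), 5 * q.2).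
Proof.
move=> [z [/cubeP pz /cubeP qz]] pq x /cubeP px; apply/cubeP => i /=.
by rewrite !mxE; have := pz i; have := qz i; have := px i; lra.
Qed.

End cubes.

(** * Shrinking cubes and neighbourhoods of small excess measure *)

Section neighbourhoods.
Context {R : realType} {n : nat}.
Implicit Types (a b x : 'rV[R]_n.+1) (U C : set 'rV[R]_n.+1).

(** A cube of measure less than [d ^+ n.+1] has side less than [d], hence lies in the sup-norm ball
    of radius [d] around each of its points. *)
Lemma near_cubes_sub x U : nbhs x U -> \forall Q \near cubes_to x, Q `<=` U.
Proof.
move=> /nbhs_ballP[d /= d0 dU].
exists (d ^+ n.+1) => [|_ [/is_cubeP[p p0 ->] /cubeP px]]; first exact: exprn_gt0.
rewrite lebesgue_mu_cube ?(ltW p0)// lte_fin ltr_pXn2r// ?nnegrE ?(ltW p0, ltW d0)//.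
move=> pd y /cubeP py; apply: dU; split=> // i j; rewrite ord1 /ball /=.
by rewrite ltr_distlC; have := px j; have := py j; lra.
Qed.

Lemma near_cubes_is_cube x : \forall Q \near cubes_to x, is_cube Q /\ Q x.
Proof. by exists 1 => [|Q []]; first exact: ltr01. Qed.

Lemma box_sub_interior_enlarged a b (d : R) : 0 < d ->
  box a b `<=` (box (a - const_mx d) (b + const_mx d))^°.
Proof.
move=> d0 x xab; apply/nbhs_ballP; exists d => //= y [_ xy] i.
have := xy ord0 i; rewrite /ball /= ltr_distlC !mxE; have := xab i; lra.
Qed.

(** The enlarged volume is a polynomial in [d], hence continuous at 0. *)
Lemma box_volume_enlarged_le a b (e : R) : 0 < e ->
  exists2 d : R, 0 < d &
    box_volume (a - const_mx d) (b + const_mx d) <= box_volume a b + e.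
Proof.
move=> e0.
pose P : {poly R} := \prod_(i < n.+1) ((b 0 i - a 0 i)%:P + 2 *: 'X).
have PE d : P.[d] = box_volume (a - const_mx d) (b + const_mx d).
  rewrite horner_prod; apply: eq_bigr => i _.
  by rewrite !hornerE !mxE; lra.
have P0 : P.[0] = box_volume a b.
  by rewrite horner_prod; apply: eq_bigr => i _; rewrite !hornerE; lra.
have /cvgrPdist_le/(_ e e0)/nbhs_ballP[d /= d0 dP] := @continuous_horner R P 0.
exists (d / 2); first by rewrite divr_gt0.
have /dP /= : ball (0 : R) d (d / 2).
  by rewrite /ball /= sub0r normrN ger0_norm; lra.
by rewrite P0 PE ler_distlC; lra.
Qed.

(** A box cover of [C] loses at most [e / 2]; enlarging its boxes puts [C] in the interior of their
    union and costs another [e / 2], split geometrically over the boxes. *)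
Lemma neighbourhood_small_excess C (e : R) :
  measurable (C : set (lebesgue_space R n)) -> (lebesgue_mu C < +oo)%E -> 0 < e ->
  exists U, [/\ measurable (U : set (lebesgue_space R n)), C `<=` U^° &
    (lebesgue_mu (U `\` C) <= e%:E)%E].
Proof.
move=> mC Cfin e0; have e20 : 0 < e / 2 by rewrite divr_gt0.
have Cfinnum : lebesgue_outer C \is a fin_num.
  by rewrite ge0_fin_numE ?lebesgue_outer_ge0.
have [_ [I [Iok Icov] <-] Ilt] := lb_ereal_inf_adherent e20 Cfinnum.
have /choice[d Hd] k : exists d : R, 0 < d /\
    box_volume ((I k).1 - const_mx d) ((I k).2 + const_mx d)
      <= box_volume (I k).1 (I k).2 + e / 2 / (2 ^ k.+1)%:R.
  have [|d d0 hd] := @box_volume_enlarged_le (I k).1 (I k).2 (e / 2 / (2 ^ k.+1)%:R).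
    by rewrite divr_gt0// ltr0n expn_gt0.
  by exists d.
pose J k := box ((I k).1 - const_mx (d k)) ((I k).2 + const_mx (d k)).
have mJ k : measurable (J k : set (lebesgue_space R n)) by exact: measurable_box.
have CU : C `<=` (\bigcup_k J k)^°.
  move=> x /Icov[k _ Ikx].
  have : (J k)^° x by apply: box_sub_interior_enlarged Ikx; exact: (Hd k).1.
  by apply: interiorS; exact: bigcup_sup.
have mU : measurable (\bigcup_k J k : set (lebesgue_space R n)).
  exact: bigcupT_measurable.
exists (\bigcup_k J k); split => //.
have Ule : (lebesgue_mu (\bigcup_k J k) <= lebesgue_mu C + e%:E)%E.
  apply: le_trans (lebesgue_outer_sigma_subadditive J) _.
  apply: (@le_trans _ _ (\sum_(k <oo) ((box_volume (I k).1 (I k).2)%:E +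
    (e / 2 / (2 ^ k.+1)%:R)%:E))%E).
    apply: lee_nneseries => k *; first exact: lebesgue_outer_ge0.
    rewrite lebesgue_outer_box -?EFinD ?lee_fin; first exact: (Hd k).2.
    by move=> i; rewrite !mxE; have := Iok k i; have := (Hd k).1; lra.
  apply: le_trans (epsilon_trick _ _ (ltW e20)) _.
    by move=> k; rewrite lee_fin box_volume_ge0.
  rewrite [in leRHS](splitr e) EFinD addeA leeD2r//; exact: ltW.
(* The Carathéodory condition for [C], tested on the union, splits off the measure of [C], which
   cancels because it is finite. *)
have := mC (\bigcup_k J k); rewrite -setDE (setIidr _); last first.
  by apply: subset_trans CU _; exact: interior_subset.
move=> UE; move: Ule; rewrite [X in (X <= _)%E -> _]UE leeD2lE//.
Qed.

End neighbourhoods.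

(** * Almost every point of a measurable set is a density point *)

Section density.
Context {R : realType} {n : nat}.
Implicit Types (U C : set 'rV[R]_n.+1).

(** Dilating a selected cube multiplies its measure by [5 ^+ n.+1], and its overlap with [S] is at
    least the fraction [t] of it. By disjointness these overlaps add up inside the union. The union
    itself is only estimated by outer measure. *)
Lemma vitali_cover_bound (V : set ('rV[R]_n.+1 * R)) (t : R)
    (S : set 'rV[R]_n.+1) :
  0 < t -> measurable (S : set (lebesgue_space R n)) ->
  (forall p, V p -> 0 < p.2 <= 1 /\
     ((t * p.2 ^+ n.+1)%:E <= lebesgue_mu (cube p `&` S))%E) ->
  (lebesgue_mu (\bigcup_(p in V) cube p)
     <= (5 ^+ n.+1 / t)%:E * lebesgue_mu ((\bigcup_(p in V) cube p) `&` S))%E.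
Proof.
move=> t0 mS VS.
have [|p Vp|D [DV tD domD]] :=
    @vitali_selection R _ _ cube (fun p : 'rV[R]_n.+1 * R => p.2) V 1.
- by move=> p /VS[].
- by apply: cube_nonempty; have [/andP[/ltW]] := VS p Vp.
have D0 p : D p -> 0 < p.2 by move=> /DV/VS[/andP[]].
have /countable_injP[f finj] := trivIset_cube_countable D D0 tD.
pose N := f @` D.
(* [g] inverts the numbering [f] on [N]; off [N] its value is a dummy, and [F] is empty there. *)
have /choice[g gN] k : exists p, N k -> D p /\ f p = k.
  have [[p Dp <-]|nN] := pselect (N k); first by exists p.
  by exists (0, 0).
pose big k := cube ((g k).1 - const_mx (2 * (g k).2), 5 * (g k).2).
pose F k : set 'rV[R]_n.+1 := if k \in N then big k else set0.
have VF : \bigcup_(p in V) cube p `<=` \bigcup_k F k.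
  move=> x [p Vp px]; have [q [Dq pq pq2]] := domD p Vp.
  exists (f q) => //; have Nq : N (f q) by exists q.
  rewrite /F mem_set// /big (_ : g (f q) = q); first exact: cube_sub_dilation px.
  by have [Dg fg] := gN _ Nq; apply: finj fg; exact: mem_set.
have mcS p : measurable (cube p `&` S : set (lebesgue_space R n)).
  by apply: measurableI => //; exact: measurable_cube.
have tN : trivIset N (fun k => cube (g k) `&` S).
  move=> i j Ni Nj [x [[gix _] [gjx _]]].
  have [Di <-] := gN i Ni; have [Dj <-] := gN j Nj.
  by congr f; apply: tD => //; exists x.
have K0 : 0 <= 5 ^+ n.+1 / t by rewrite divr_ge0 ?ltW// exprn_gt0.
apply: (@le_trans _ _ (\sum_(k <oo) lebesgue_mu (F k))%E).
  exact: le_trans (le_lebesgue_outer VF) (lebesgue_outer_sigma_subadditive F).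
apply: (@le_trans _ _ (\sum_(k <oo | k \in N)
    ((5 ^+ n.+1 / t)%:E * lebesgue_mu (cube (g k) `&` S)))%E).
  rewrite [leRHS]eseries_mkcond; apply: lee_nneseries => k *.
    exact: lebesgue_outer_ge0.
  rewrite /F; case: ifPn => [/set_mem Nk|_];
    last by rewrite /lebesgue_mu lebesgue_outer0.
  have [Dk _] := gN k Nk; have g0 := D0 _ Dk.
  rewrite lebesgue_mu_cube ?mulr_ge0 ?(ltW g0)//=.
  apply: (@le_trans _ _ ((5 ^+ n.+1 / t)%:E * (t * (g k).2 ^+ n.+1)%:E)%E).
    by rewrite -EFinM lee_fin mulrA divfK ?gt_eqF// exprMn.
  by rewrite lee_wpmul2l ?lee_fin//; have [_] := VS _ (DV _ Dk).
rewrite nneseriesZl; last by move=> k _; exact: lebesgue_outer_ge0.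
rewrite lee_wpmul2l ?lee_fin//.
have <- := @measure_bigcup _ _ _ (@lebesgue_mu R n) N _ (fun k _ => mcS (g k)) tN.
apply: le_lebesgue_outer => x [k Nk [gkx Sx]]; split=> //; exists (g k) => //.
by apply: DV; have [] := gN k Nk.
Qed.

Lemma nondensity_points_null C (t : R) :
  measurable (C : set (lebesgue_space R n)) -> (lebesgue_mu C < +oo)%E -> 0 < t ->
  lebesgue_mu [set x | C x /\ ~ \forall Q \near cubes_to x,
    (lebesgue_mu (Q `\` C) <= t%:E * lebesgue_mu Q)%E] = 0%E.
Proof.
move=> mC Cfin t0; set B := (X in lebesgue_mu X).
apply/eqP; rewrite eq_le; apply/andP; split; last exact: lebesgue_outer_ge0.
apply/lee_addgt0Pr => e e0; rewrite add0e.
have K0 : 0 < 5 ^+ n.+1 / t by rewrite divr_gt0// exprn_gt0.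
(* This excess is chosen so that the factor in [vitali_cover_bound] turns it into [e]. *)
have [|U [mU CU Ue]] := @neighbourhood_small_excess R n C (e / (5 ^+ n.+1 / t)) mC Cfin.
  by rewrite divr_gt0.
pose V := [set p : 'rV[R]_n.+1 * R | [/\ 0 < p.2 <= 1, cube p `<=` U &
  ((t * p.2 ^+ n.+1)%:E <= lebesgue_mu (cube p `&` ~` C))%E]].
have BV : B `<=` \bigcup_(p in V) cube p.
  move=> x [Cx xnd]; apply: contrapT => nV; apply: xnd.
  (* Measure below 1 forces side below 1, the uniform size bound that the selection needs. *)
  have small : \forall Q \near cubes_to x, (lebesgue_mu Q < 1%:E)%E.
    by exists 1 => [|Q []]; first exact: ltr01.
  apply: filterS3 (near_cubes_sub _ _ (CU x Cx)) (near_cubes_is_cube x) small.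
  move=> _ /[swap] -[/is_cubeP[p p0 ->] px] pU.
  rewrite lebesgue_mu_cube ?(ltW p0)// lte_fin expr_lt1 ?(ltW p0)// => p1.
  rewrite leNgt; apply/negP => tp; apply: nV; exists p => //; split => //.
  - by rewrite p0 ltW.
  - by rewrite -setDE EFinM ltW.
apply: le_trans (le_lebesgue_outer BV) _.
apply: (@le_trans _ _ ((5 ^+ n.+1 / t)%:E * (e / (5 ^+ n.+1 / t))%:E)%E).
  apply: le_trans (@vitali_cover_bound V t _ t0 (measurableC mC) _) _.
    by move=> p [].
  rewrite lee_wpmul2l ?lee_fin ?(ltW K0)//; apply: le_trans Ue.
  by apply: le_lebesgue_outer => x [[p [_ pU _] px] nCx]; split; [exact: pU|].
by rewrite -EFinM lee_fin mulrC divfK// gt_eqF.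
Qed.

(** Cutting [E] with the cubes [K N], which exhaust the space, gives finite measure, and the values
    [k.+1%:R^-1] replace all [t], so countably many null sets suffice. Going back from the cut set
    to [E] only shrinks the part of [Q] outside it. *)
Lemma ae_density_point (E : set 'rV[R]_n.+1) :
  measurable (E : set (lebesgue_space R n)) ->
  {ae (@lebesgue_mu R n), forall x, E x -> forall t : R, 0 < t ->
    \forall Q \near cubes_to x, (lebesgue_mu (Q `\` E) <= t%:E * lebesgue_mu Q)%E}.
Proof.
move=> mE.
pose K (N : nat) : set 'rV[R]_n.+1 := cube (const_mx (- N%:R), N%:R *+ 2).
have Kcov x : exists N, K N x.
  pose c (i : 'I_n.+1) := Num.truncn `|x 0 i|.
  exists (\max_i c i).+1; apply/cubeP => i.
  have : `|x 0 i| <= (\max_i c i).+1%:R.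
    apply: (@le_trans _ _ (c i).+1%:R); first exact/ltW/truncnS_gt.
    by rewrite ler_nat ltnS; exact: leq_bigmax.
  rewrite mxE /= -mulr_natr ler_norml; lra.
pose bad N k := [set x | (E `&` K N) x /\ ~ \forall Q \near cubes_to x,
    (lebesgue_mu (Q `\` (E `&` K N)) <= (k.+1%:R^-1)%:E * lebesgue_mu Q)%E].
have badP N : {ae (@lebesgue_mu R n), forall x, forall k, ~ bad N k x}.
  apply: ae_foralln => k.
  suff : (@lebesgue_mu R n).-negligible (bad N k).
    by apply: negligibleS => x /= /contrapT.
  have b0 : lebesgue_mu (bad N k) = 0%E.
    apply: nondensity_points_null; [|apply: (@le_lt_trans _ _ (lebesgue_mu (K N)))|].
    - by apply: measurableI => //; exact: measurable_cube.
    - by apply: le_lebesgue_outer => x [].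
    - by rewrite lebesgue_mu_cube ?mulrn_wge0// ltry.
    - by rewrite invr_gt0.
  (* Negligibility asks for a measurable null superset; a set of outer measure 0 is itself
     Carathéodory measurable. *)
  exists (bad N k); split => //; apply: le_caratheodory_measurable => X /=.
  rewrite -[leRHS]add0e; apply: leeD; last by apply: le_lebesgue_outer => x [].
  by rewrite -b0; apply: le_lebesgue_outer => x [].
have := ae_foralln badP; apply: filterS => x xgood Ex t t0.
have [N KNx] := Kcov x.
have [k kt] : exists k, k.+1%:R^-1 < t.
  exists (Num.truncn t^-1).
  by rewrite invf_plt ?posrE// truncnS_gt.
have := xgood N k; rewrite /bad /= => /not_andP[[]//|/contrapT].
apply: filterS => Q QE; apply: (le_trans _ (le_trans QE _)).
  by apply: le_lebesgue_outer => y [Qy nEy]; split => // -[].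
by rewrite lee_wpmul2r ?lebesgue_outer_ge0// lee_fin ltW.
Qed.
End density.

(** * Convergence of medians *)

(** Rationals are dense enough to test convergence, and being countable they keep the exceptional
    sets null. For infinite [v] one of the two hypotheses is vacuous and the other suffices. *)
Lemma ereal_cvg_rat_squeeze (R : realType) (T : Type) (F : set_system T)
    (FF : Filter F) (u : T -> \bar R) (v : \bar R) :
  (forall q : rat, ((ratr q)%:E < v)%E -> \forall z \near F, ((ratr q)%:E <= u z)%E) ->
  (forall q : rat, (v < (ratr q)%:E)%E -> \forall z \near F, (u z <= (ratr q)%:E)%E) ->
  u @ F --> v.
Proof.
move=> lower upper A.
case: v lower upper => [r||] lower upper.
- move=> rA; have /nbhs_ballP[e /= e0 eA] : nbhs r (fun y => A y%:E) by [].
  have [|q1] := @rat_in_itvoo R (r - e) r; first by rewrite gtrBl.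
  rewrite in_itv /= => /andP[rq1 q1r].
  have [|q2] := @rat_in_itvoo R r (r + e); first by rewrite ltrDl.
  rewrite in_itv /= => /andP[rq2 q2r].
  have lo : \forall z \near F, ((ratr q1)%:E <= u z)%E by apply: lower; rewrite lte_fin.
  have up : \forall z \near F, (u z <= (ratr q2)%:E)%E by apply: upper; rewrite lte_fin.
  apply: filterS2 lo up => z /=; case: (u z) => [y||]//.
  rewrite !lee_fin => q1y yq2; apply: eA.
  by rewrite /ball /= ltr_distlC; lra.
- move=> [M [Mreal MA]].
  have [|q] := @rat_in_itvoo R M (M + 1); first by rewrite ltrDl.
  rewrite in_itv /= => /andP[Mq _].
  apply: filterS (lower q (ltry _)) => z qz; apply: MA.
  by apply: lt_le_trans qz; rewrite lte_fin.
- move=> [M [Mreal MA]].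
  have [|q] := @rat_in_itvoo R (M - 1) M; first by rewrite gtrBl.
  rewrite in_itv /= => /andP[_ qM].
  apply: filterS (upper q (ltNyr _)) => z zq; apply: MA.
  by apply: le_lt_trans zq _; rewrite lte_fin.
Qed.

Section median.
Context {R : realType} {n : nat} (f : 'rV[R]_n.+1 -> \bar R) (s : R).
Implicit Types (Q : set 'rV[R]_n.+1) (x : 'rV[R]_n.+1) (M : R).

Lemma max_median_ge Q M :
  (lebesgue_mu (Q `&` [set y | (f y < M%:E)%E]) <= s%:E * lebesgue_mu Q)%E ->
  (M%:E <= max_median f s Q)%E.
Proof. by move=> MQ; apply: ereal_sup_ubound; exists M. Qed.

(** Sublevel sets grow with the level, so any [N > M] inherits the excess and is not admissible in
    the supremum. *)
Lemma max_median_le Q M :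
  (s%:E * lebesgue_mu Q < lebesgue_mu (Q `&` [set y | (f y < M%:E)%E]))%E ->
  (max_median f s Q <= M%:E)%E.
Proof.
move=> QM; apply: ge_ereal_sup => _ [N /= NQ <-]; rewrite lee_fin leNgt.
apply/negP => MN; move: QM; apply/negP; rewrite -leNgt; apply: le_trans NQ.
apply: le_lebesgue_outer => y [Qy fyM]; split => //.
by apply: lt_trans fyM _; rewrite lte_fin.
Qed.

Lemma max_median_cvg x :
  (forall q : rat, ((ratr q)%:E < f x)%E -> \forall Q \near cubes_to x,
     (lebesgue_mu (Q `&` [set y | (f y < (ratr q)%:E)%E]) <= s%:E * lebesgue_mu Q)%E) ->
  (forall q : rat, (f x < (ratr q)%:E)%E -> \forall Q \near cubes_to x,
     (s%:E * lebesgue_mu Q < lebesgue_mu (Q `&` [set y | (f y < (ratr q)%:E)%E]))%E) ->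
  max_median f s Q @[Q --> cubes_to x] --> f x.
Proof.
move=> lower upper; apply: ereal_cvg_rat_squeeze => q qx.
  by apply: filterS (lower q qx) => Q; exact: max_median_ge.
by apply: filterS (upper q qx) => Q; exact: max_median_le.
Qed.

Lemma max_median_cvg_continuity_point x : 0 <= s -> s < 1 ->
  {for x, continuous f} -> max_median f s Q @[Q --> cubes_to x] --> f x.
Proof.
move=> s0 s1 fx; apply: max_median_cvg => q qx.
  have : nbhs x [set y | ((ratr q)%:E < f y)%E].
    apply: (fx [set z | ((ratr q)%:E < z)%E]); apply: open_nbhs_nbhs.
    by split => //; exact: open_ereal_gt_ereal.
  move=> /near_cubes_sub; apply: filterS => Q QU.
  rewrite (_ : _ `&` _ = set0) ?lebesgue_outer0.
    by rewrite [lebesgue_mu set0]lebesgue_outer0 mule_ge0// lebesgue_outer_ge0.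
  apply/seteqP; split => // y [/QU /= qy]; rewrite /= => yq.
  by have := lt_trans qy yq; rewrite ltxx.
have : nbhs x [set y | (f y < (ratr q)%:E)%E].
  apply: (fx [set z | (z < (ratr q)%:E)%E]); apply: open_nbhs_nbhs.
  by split => //; exact: open_ereal_lt_ereal.
move=> /near_cubes_sub QU; apply: filterS2 QU (near_cubes_is_cube x).
move=> Q QU [/is_cubeP[p p0 Qp] _]; rewrite (setIidl QU) Qp.
(* The strict inequality comes from [s < 1] and the positive finite measure of the cube. *)
by rewrite lebesgue_mu_cube ?(ltW p0)// -EFinM lte_fin gtr_pMl// exprn_gt0.
Qed.

Lemma max_median_cvg_ae :
  measurable_fun [set: lebesgue_space R n] f -> 0 < s -> s < 1 ->
  {ae (@lebesgue_mu R n), forall x, max_median f s Q @[Q --> cubes_to x] --> f x}.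
Proof.
move=> mf s0 s1.
(* An enumeration of the sublevel sets at rational levels; a number that codes no rational gets
   level 0. *)
pose E k : set 'rV[R]_n.+1 := [set y | (f y < (ratr (odflt 0 (unpickle k)))%:E)%E].
have mE k : measurable (E k : set (lebesgue_space R n)).
  rewrite -[X in measurable X]setTI.
  exact: mf measurableT _ (emeasurable_itv `]-oo, _[).
have aeE := ae_foralln (fun k => ae_density_point _ (mE k)).
have aeCE := ae_foralln (fun k => ae_density_point _ (measurableC (mE k))).
apply: filterS2 aeE aeCE => x xE xCE.
have Eq (q : rat) : [set y | (f y < (ratr q)%:E)%E] = E (pickle q).
  by rewrite /E pickleK.
apply: max_median_cvg => q qx; rewrite Eq.
  have nE : (~` E (pickle q)) x.
    by rewrite -Eq /= => xq; have := lt_trans qx xq; rewrite ltxx.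
  by apply: filterS (xCE _ nE s s0) => Q; rewrite setDE setCK.
have Ex : E (pickle q) x by rewrite -Eq.
(* If [E] filled at most the fraction [s] of [Q], its complement filling at most [(1 - s) / 2], the
   total would be [(1 + s) / 2 < 1]. *)
have t0 : 0 < (1 - s) / 2 by lra.
apply: filterS2 (xE _ Ex _ t0) (near_cubes_is_cube x).
move=> Q + [/is_cubeP[p p0 Qp] _].
have Qm : lebesgue_mu Q = (p.2 ^+ n.+1)%:E by rewrite Qp lebesgue_mu_cube// ltW.
have sub : (lebesgue_mu Q <= lebesgue_mu (Q `&` E (pickle q))
    + lebesgue_mu (Q `\` E (pickle q)))%E.
  have := outer_measureU2 (@lebesgue_outer R n) (Q `&` E (pickle q))
    (Q `\` E (pickle q)).
  by rewrite setUIDK.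
move=> nQE; rewrite ltNge; apply/negP => QE.
have := le_trans sub (leeD QE nQE).
rewrite Qm -!EFinM -EFinD lee_fin -mulrDl leNgt => /negP; apply.
by rewrite gtr_pMl ?exprn_gt0//; lra.
Qed.

End median.

Theorem theorem2p1 (R : realType) (n : nat) (f : 'rV[R]_n.+1 -> \bar R)
    (s : R)
    (mf : measurable_fun [set: lebesgue_space R n] f)
    (finf : {ae (@lebesgue_mu R n), forall x, f x \is a fin_num})
    (s0 : 0 < s) (s1 : s < 1) :
  {ae (@lebesgue_mu R n), forall x,
     max_median f s Q @[Q --> cubes_to x] --> f x} /\
  (forall x : 'rV[R]_n.+1, {for x, continuous f} ->
     max_median f s Q @[Q --> cubes_to x] --> f x).
Proof.
split; first exact: max_median_cvg_ae.
by move=> x; apply: max_median_cvg_continuity_point => //; exact: ltW.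
Qed.
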